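(* Let $G=G_1\vee G_2$ be a connected cograph of order $n$ without universal vertices, where $G_1$ and $G_2$ are (nonempty) cographs. Then $\gamma_{11}(G)=2$ if both $G_1$ and $G_2$ have at least one isolated vertex, and $\gamma_{11}(G)=n$ in any other case.
   Context: Graphs are finite, undirected and simple; $G_1$ and $G_2$ need not be connected. The join $G_1\vee G_2$ is obtained from the disjoint union of $G_1$ and $G_2$ by adding all edges between vertices of $G_1$ and vertices of $G_2$. Cographs are defined inductively: every single-vertex graph is a cograph; the disjoint union of two cographs is a cograph; the join of two cographs is a cograph. A vertex is universal if it is adjacent to every other vertex of the graph, and isolated if it has no neighbors in the graph. A set $S\subseteq V(G)$ is a perfect dominating set if every vertex not in $S$ is adjacent to exactly one vertex of $S$ (in particular $S=V(G)$ is allowed); $\gamma_{11}(G)$ is the minimum cardinality of a perfect dominating set of $G$. *)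

(* Defs.v *)
(* Library: Mathematical Components. *)
From mathcomp Require Import all_boot.

Set Implicit Arguments.
Unset Strict Implicit.
Unset Printing Implicit Defensive.

Record sgraph : Type := SGraph {
  vertex :> finType;
  adj : rel vertex;
  adj_sym : symmetric adj;
  adj_irrefl : irreflexive adj }.

Definition sg_iso (G H : sgraph) : Prop :=
  exists2 f : G -> H, bijective f & forall x y, adj (f x) (f y) = adj x y.

Lemma sg_iso_refl (G : sgraph) : sg_iso G G.
Proof. by exists id => //; exists id. Qed.

Lemma sg_iso_card (G H : sgraph) : sg_iso G H -> #|G| = #|H|.
Proof. by case=> f /bij_eq_card. Qed.

Section UnionJoin.
Variables G1 G2 : sgraph.

(* [cross] is the adjacency between a vertex of G1 and a vertex of G2:
   false for the disjoint union, true for the join. *)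
Definition sum_adj (cross : bool) (x y : G1 + G2) : bool :=
  match x, y with
  | inl a, inl b => adj a b
  | inr a, inr b => adj a b
  | _, _ => cross
  end.

Lemma sum_adj_sym cross : symmetric (sum_adj cross).
Proof. by case=> x [] y //=; rewrite adj_sym. Qed.

Lemma sum_adj_irrefl cross : irreflexive (sum_adj cross).
Proof. by case=> x /=; rewrite adj_irrefl. Qed.

Definition sunion : sgraph := SGraph (sum_adj_sym false) (sum_adj_irrefl false).
Definition sjoin : sgraph := SGraph (sum_adj_sym true) (sum_adj_irrefl true).
End UnionJoin.

(* Graphs are taken up to isomorphism, hence the isomorphisms in the last two
   constructors. *)
Inductive cograph : sgraph -> Prop :=
| cograph_single (G : sgraph) : #|G| = 1 -> cograph G
| cograph_union (G G1 G2 : sgraph) :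
    cograph G1 -> cograph G2 -> sg_iso G (sunion G1 G2) -> cograph G
| cograph_join (G G1 G2 : sgraph) :
    cograph G1 -> cograph G2 -> sg_iso G (sjoin G1 G2) -> cograph G.

Lemma cograph_card_gt0 (G : sgraph) : cograph G -> 0 < #|G|.
Proof.
elim=> {G} [G -> //|G G1 G2 _ h1 _ _ /sg_iso_card|G G1 G2 _ h1 _ _ /sg_iso_card] ->;
  by rewrite card_sum addn_gt0 h1.
Qed.

Section Invariants.
Variable G : sgraph.

Definition connected : bool := [forall x : G, forall y : G, connect (@adj G) x y].

Definition universal (v : G) : bool := [forall u : G, (u != v) ==> adj v u].

Definition isolated (v : G) : bool := [forall u : G, ~~ adj v u].

Definition perfect_dominating (S : {set G}) : bool :=
  [forall v : G, (v \notin S) ==> (#|[set u in S | adj v u]| == 1)].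

Lemma perfect_dominating_setT : perfect_dominating [set: G].
Proof. by apply/forallP => v; rewrite inE. Qed.

Definition gamma11 : nat :=
  #|[arg min_(S < [set: G] | perfect_dominating S) #|S|]|.

Lemma gamma11P :
  (exists2 S : {set G}, perfect_dominating S & #|S| = gamma11) /\
  (forall S : {set G}, perfect_dominating S -> gamma11 <= #|S|).
Proof.
rewrite /gamma11; case: arg_minnP; first exact: perfect_dominating_setT.
by move=> S pS minS; split=> //; exists S.
Qed.
End Invariants.

(* Main.v *)
Require Import Defs.
From mathcomp Require Import all_boot.

(** Let [S] be a perfect dominating set of the join and [S1], [S2] its traces
    on the two sides.  A vertex of one side sees all of the opposite trace, so
    if it lies outside [S] the opposite trace has at most one element, and then
    the opposite side, having at least two vertices, is not contained in [S]
    either.  Hence a proper [S] has both traces of size at most one.  It cannot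
    be empty, and it cannot be a single vertex, which would be universal; so
    [S] is a pair [{a, b}] with one vertex on each side.  Every other vertex on
    the side of [a] already sees [b], hence does not see [a]: [a] is isolated
    in its side, and so is [b].

    Therefore the perfect dominating sets are the whole vertex set and the
    pairs of isolated vertices taken one from each side
    ([perfect_dominating_join], [perfect_dominating_pair]), and the minimum can
    be read off.  Invariance under isomorphism ([gamma11_iso],
    [universal_iso]) carries the result from the join to [G]. *)

Set Implicit Arguments.
Unset Strict Implicit.
Unset Printing Implicit Defensive.

(** * Invariance under isomorphism *)

Section Isomorphism.
Variables (G H : sgraph) (f : G -> H).
Hypotheses (f_bij : bijective f) (f_adj : forall x y, adj (f x) (f y) = adj x y).

Lemma universal_iso v : universal v -> universal (f v).
Proof.
case: f_bij => g fK gK /forallP univ_v; apply/forallP => u.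
by rewrite -(gK u) f_adj (can_eq fK).
Qed.

Lemma perfect_dominating_preim (S : {set H}) :
  perfect_dominating S -> perfect_dominating (f @^-1: S).
Proof.
move=> /forallP pdS; apply/forallP => v; have := pdS (f v).
suff -> : #|[set u in f @^-1: S | adj v u]| = #|[set w in S | adj (f v) w]|.
  by rewrite inE.
have -> : [set u in f @^-1: S | adj v u] = f @^-1: [set w in S | adj (f v) w].
  by apply/setP => u; rewrite !inE f_adj.
exact: on_card_preimset (onW_bij _ f_bij).
Qed.

Lemma gamma11_le_iso : gamma11 G <= gamma11 H.
Proof.
have [[S pdS <-] _] := gamma11P H; have [_ minG] := gamma11P G.
rewrite -(on_card_preimset (onW_bij _ f_bij)).
exact/minG/perfect_dominating_preim.
Qed.

End Isomorphism.

Lemma sg_iso_sym (G H : sgraph) : sg_iso G H -> sg_iso H G.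
Proof.
case=> f [g fK gK] f_adj; exists g; first by exists f.
by move=> x y; rewrite -f_adj !gK.
Qed.

Lemma gamma11_iso (G H : sgraph) : sg_iso G H -> gamma11 G = gamma11 H.
Proof.
move=> isoGH; have [g g_bij g_adj] := sg_iso_sym isoGH.
case: isoGH => f f_bij f_adj; apply/eqP.
by rewrite eqn_leq (gamma11_le_iso f_bij) ?(gamma11_le_iso g_bij).
Qed.

(** * Perfect dominating sets of small size *)

Section SmallSets.
Variable G : sgraph.

Lemma perfect_dominating_neq0 (v : G) (S : {set G}) :
  perfect_dominating S -> S != set0.
Proof.
move=> /forallP/(_ v) pdv; apply: contraTneq pdv => ->.
suff -> : [set u in set0 | adj v u] = set0 by rewrite inE cards0.
by apply/setP => u; rewrite !inE.
Qed.

(** This is what rules out one-element sets when no vertex is universal. *)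
Lemma perfect_dominating1 (v : G) : perfect_dominating [set v] -> universal v.
Proof.
move=> /forallP pdv; apply/forallP => u; have := pdv u.
rewrite inE; case: (u != v) => //= /eqP card1.
have /card_gt0P[w] : 0 < #|[set w in [set v] | adj u w]| by rewrite card1.
by rewrite !inE => /andP[/eqP->]; rewrite adj_sym.
Qed.

End SmallSets.

(** * Perfect dominating sets of a join *)

Lemma card_sum_preim (T1 T2 : finType) (S : {set T1 + T2}) :
  #|S| = #|inl @^-1: S| + #|inr @^-1: S|.
Proof.
rewrite -!sum1_card big_sumType.
by congr (_ + _); apply: eq_bigl => x; rewrite inE.
Qed.

Section Join.
Variables G1 G2 : sgraph.
Implicit Type S : {set sjoin G1 G2}.

(** A vertex sees the whole opposite side, so these two counts turn the
    domination condition into equations between cardinalities of the traces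
    of [S] on the two sides. *)
Lemma card_join_nbrs_inl S (a : G1) :
  #|[set u in S | adj (inl a : sjoin G1 G2) u]|
    = #|[set x : G1 in inl @^-1: S | adj a x]| + #|(inr : G2 -> _) @^-1: S|.
Proof.
by rewrite card_sum_preim; congr (_ + _); apply: eq_card => x; rewrite !inE ?andbT.
Qed.

Lemma card_join_nbrs_inr S (b : G2) :
  #|[set u in S | adj (inr b : sjoin G1 G2) u]|
    = #|(inl : G1 -> _) @^-1: S| + #|[set y : G2 in inr @^-1: S | adj b y]|.
Proof.
by rewrite card_sum_preim; congr (_ + _); apply: eq_card => x; rewrite !inE ?andbT.
Qed.

(** The vertex of the pair on the opposite side is a neighbour, and the one on
    the same side, being isolated there, is not. *)
Lemma perfect_dominating_pair (a : G1) (b : G2) :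
  isolated a -> isolated b ->
  perfect_dominating [set (inl a : sjoin G1 G2); inr b].
Proof.
move=> /forallP iso_a /forallP iso_b; apply/forallP => v; apply/implyP => _.
case: v => [x|y].
- apply/cards1P; exists (inr b); apply/setP => -[z|z]; rewrite !inE /= ?andbT //.
  by apply/andP => -[/orP[/eqP[->]|//]]; rewrite adj_sym; apply/negP/iso_a.
- apply/cards1P; exists (inl a); apply/setP => -[z|z]; rewrite !inE /= ?andbT ?orbF //.
  by apply/andP => -[/eqP[->]]; rewrite adj_sym; apply/negP/iso_b.
Qed.

Hypothesis no_univ : ~ exists v : sjoin G1 G2, universal v.

(** The only vertex of a one-vertex side would be universal. *)
Lemma join_side_card_neq1 : #|G1| != 1 /\ #|G2| != 1.
Proof.
split; apply/eqP => card1; apply: no_univ.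
  have /fintype1[a aP] := card1; exists (inl a).
  by apply/forallP => -[x|y]; rewrite ?(aP x) ?eqxx //; apply/implyP.
have /fintype1[b bP] := card1; exists (inr b).
by apply/forallP => -[x|y]; rewrite ?(bP y) ?eqxx //; apply/implyP.
Qed.

Hypotheses (G1_gt0 : 0 < #|G1|) (G2_gt0 : 0 < #|G2|).

(** A vertex outside [S] bounds the opposite trace by one; since each side has
    two vertices, the bound propagates back and [S] has at most two vertices.
    The empty set dominates nothing and a single dominating vertex would be
    universal, so both traces of a proper [S] are singletons. *)
Lemma perfect_dominating_join S : perfect_dominating S ->
  S = setT \/
  exists a b, [/\ isolated a, isolated b & S = [set (inl a : sjoin G1 G2); inr b]].
Proof.
move=> pdS; have [->|S_neqT] := eqVneq S setT; [by left | right].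
have [G1_neq1 G2_neq1] := join_side_card_neq1.
have G1_gt1 : 1 < #|G1| by rewrite ltn_neqAle eq_sym G1_neq1.
have G2_gt1 : 1 < #|G2| by rewrite ltn_neqAle eq_sym G2_neq1.
pose S1 : {set G1} := inl @^-1: S; pose S2 : {set G2} := inr @^-1: S.
have out1 x : x \notin S1 -> #|[set z in S1 | adj x z]| + #|S2| = 1.
  rewrite inE => xS; rewrite -card_join_nbrs_inl.
  by move/forallP/(_ (inl x)): pdS; rewrite xS => /eqP.
have out2 y : y \notin S2 -> #|S1| + #|[set z in S2 | adj y z]| = 1.
  rewrite inE => yS; rewrite -card_join_nbrs_inr.
  by move/forallP/(_ (inr y)): pdS; rewrite yS => /eqP.
have outP (T : finType) (A : {set T}) : 1 < #|T| -> #|A| <= 1 ->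
    exists x, x \notin A.
  move=> T_gt1 A_le1; suff /subsetPn[x _ xA] : ~~ (setT \subset A) by exists x.
  apply: contraL A_le1 => /subset_leq_card; rewrite cardsT -ltnNge.
  exact: leq_trans.
have bound1 x : x \notin S1 -> #|S2| <= 1 by move/out1 <-; apply: leq_addl.
have bound2 y : y \notin S2 -> #|S1| <= 1 by move/out2 <-; apply: leq_addr.
(* The vertex missed on one side yields a missed vertex on the other. *)
have [S1_le1 S2_le1] : #|S1| <= 1 /\ #|S2| <= 1.
  have /subsetPn[[x|y] _ vS] : ~~ (setT \subset S) by rewrite subTset.
    have S2_le1 : #|S2| <= 1 by apply: (bound1 x); rewrite inE.
    by have [y /bound2] := outP _ _ G2_gt1 S2_le1.
  have S1_le1 : #|S1| <= 1 by apply: (bound2 y); rewrite inE.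
  by have [x /bound1] := outP _ _ G1_gt1 S1_le1.
have S_gt1 : 1 < #|S1| + #|S2|.
  rewrite -card_sum_preim ltn_neqAle eq_sym card_gt0.
  have /card_gt0P[x0 _] := G1_gt0.
  rewrite (perfect_dominating_neq0 (inl x0 : sjoin G1 G2) pdS) andbT.
  apply/negP => /cards1P[v SE]; apply: no_univ; exists v.
  by apply: perfect_dominating1; rewrite -SE.
have [S1_1 S2_1] : #|S1| = 1 /\ #|S2| = 1.
  by move: S1_le1 S2_le1 S_gt1; case: #|S1| #|S2| => [|[|?]] [|[|?]].
have /eqP/cards1P[a S1E] := S1_1; have /eqP/cards1P[b S2E] := S2_1.
exists a, b; split.
- apply/forallP => x; have [->|x_neq_a] := eqVneq x a; first by rewrite adj_irrefl.
  (* The single neighbour of [x] in [S] is already [b], so it is not [a]. *)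
  have := out1 x; rewrite S1E S2_1 inE x_neq_a => /(_ isT)/eqP.
  rewrite addn1 eqSS cards_eq0 => /eqP/setP/(_ a).
  by rewrite !inE eqxx /= adj_sym => ->.
- apply/forallP => y; have [->|y_neq_b] := eqVneq y b; first by rewrite adj_irrefl.
  have := out2 y; rewrite S2E S1_1 inE y_neq_b => /(_ isT)/eqP.
  rewrite add1n eqSS cards_eq0 => /eqP/setP/(_ b).
  by rewrite !inE eqxx /= adj_sym => ->.
- apply/setP => -[x|y]; rewrite !inE ?orbF /=.
    by move/setP/(_ x): S1E; rewrite !inE.
  by move/setP/(_ y): S2E; rewrite !inE.
Qed.

Lemma gamma11_join_isolated :
  (exists x : G1, isolated x) -> (exists y : G2, isolated y) ->
  gamma11 (sjoin G1 G2) = 2.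
Proof.
move=> [a iso_a] [b iso_b]; have [[S pdS gammaE] minS] := gamma11P (sjoin G1 G2).
rewrite -gammaE in minS *.
have [SE | [a' [b' [_ _ ->]]]] := perfect_dominating_join pdS; last first.
  by rewrite cards2.
apply/eqP; rewrite eqn_leq; apply/andP; split; last first.
  by rewrite SE cardsT card_sum (leq_add G1_gt0 G2_gt0).
have := minS _ (perfect_dominating_pair iso_a iso_b).
by rewrite cards2.
Qed.

Lemma gamma11_join_nonisolated :
  ~ ((exists x : G1, isolated x) /\ (exists y : G2, isolated y)) ->
  gamma11 (sjoin G1 G2) = #|sjoin G1 G2|.
Proof.
move=> no_iso; have [[S pdS <-] _] := gamma11P (sjoin G1 G2).
have [-> | [a [b [iso_a iso_b _]]]] := perfect_dominating_join pdS.
  exact: cardsT.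
by case: no_iso; split; [exists a | exists b].
Qed.

End Join.

Theorem corollary1 (G G1 G2 : sgraph) (n : nat)
    (cographG1 : cograph G1) (cographG2 : cograph G2)
    (joinG : sg_iso G (sjoin G1 G2))
    (cographG : cograph G) (connectedG : connected G) (orderG : #|G| = n)
    (no_universal : ~ exists v : G, universal v) :
  ((exists x : G1, isolated x) /\ (exists y : G2, isolated y) ->
     gamma11 G = 2) /\
  (~ ((exists x : G1, isolated x) /\ (exists y : G2, isolated y)) ->
     gamma11 G = n).
Proof.
have no_univ : ~ exists v : sjoin G1 G2, universal v.
  have [g g_bij g_adj] := sg_iso_sym joinG.
  by case=> v univ_v; apply: no_universal; exists (g v); apply: universal_iso univ_v.
have G1_gt0 := cograph_card_gt0 cographG1.
have G2_gt0 := cograph_card_gt0 cographG2.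
rewrite -orderG (sg_iso_card joinG) (gamma11_iso joinG); split.
  by case; apply: gamma11_join_isolated.
exact: gamma11_join_nonisolated.
Qed.
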